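(* Let $n\geq 1$ and $p\in[0,1]$. For any non-decreasing boolean function $f:\{0,1\}^n\to\{0,1\}$ with $P(f=1)>0$, we have $$P(f=1)\,\leq\,2\exp\Big(-\frac{1}{2n}\Big((1-p)\,E\big(|\mathcal P(f)|\,\big|\,f=1\big)\Big)^2\Big)\,.$$
   Context: Let $\Omega=\{0,1\}^n$, with elements $\omega=(\omega(1),\dots,\omega(n))$. The probability $P$ on $\Omega$ is the Bernoulli product measure of parameter $p$: $P(\omega)=\prod_{1\leq i\leq n}p^{\omega(i)}(1-p)^{1-\omega(i)}$ (with $0^0=1$), and $E$ is the expectation with respect to $P$. For $\omega\in\Omega$ and $i\in\{1,\dots,n\}$, $\omega^i$ (respectively $\omega_i$) denotes the configuration equal to $\omega$ except that its $i$-th component is set to $1$ (respectively to $0$). A boolean function is a function $f:\Omega\to\{0,1\}$; it is non-decreasing if $f(\omega_i)\leq f(\omega^i)$ for all $\omega\in\Omega$ and all $i\in\{1,\dots,n\}$. The coordinate $i$ is pivotal for $f$ in $\omega$ if $f(\omega^i)\neq f(\omega_i)$. The pivotal set $\mathcal P(f,\omega)\subset\{1,\dots,n\}$ is the set of the coordinates that are pivotal for $f$ in $\omega$; $\mathcal P(f)$ denotes the random set $\omega\mapsto\mathcal P(f,\omega)$, and $|\cdot|$ denotes cardinality. For a random variable $Y$ on $\Omega$, $E(Y\,|\,f=1)$ denotes $\frac{1}{P(f=1)}\sum_{\omega:\,f(\omega)=1}Y(\omega)P(\omega)$. *)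

(* Defs.v *)
From HB Require Import structures.
From mathcomp Require Import all_boot all_order all_algebra.
From mathcomp Require Import reals sequences exp.
Set Implicit Arguments.
Unset Strict Implicit.
Unset Printing Implicit Defensive.

Import Order.TTheory GRing.Theory Num.Theory.
Local Open Scope ring_scope.

Notation Omega n := {ffun 'I_n -> bool}.

(* Coordinates are numbered from 0 to n-1. [set_coord w i true] and
   [set_coord w i false] are the configurations $\omega^i$ and $\omega_i$. *)
Definition set_coord (n : nat) (w : Omega n) (i : 'I_n) (b : bool) : Omega n :=
  [ffun j => if j == i then b else w j].

(* The comparison is the one of nat, through the coercion of bool to nat. *)
Definition nondecreasing_bool (n : nat) (f : Omega n -> bool) : Prop :=
  forall (w : Omega n) (i : 'I_n),
    (f (set_coord w i false) <= f (set_coord w i true))%N.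

Definition pivotal (n : nat) (f : Omega n -> bool) (w : Omega n) (i : 'I_n)
  : bool := f (set_coord w i true) != f (set_coord w i false).

Definition pivotal_set (n : nat) (f : Omega n -> bool) (w : Omega n)
  : {set 'I_n} := [set i | pivotal f w i].

(* Mass of a single configuration; [x ^+ 0 = 1] for every x, including 0. *)
Definition bernoulli_mass (R : realType) (n : nat) (p : R) (w : Omega n) : R :=
  \prod_(i < n) (p ^+ (w i) * (1 - p) ^+ (1 - w i)%N).

Definition Pr (R : realType) (n : nat) (p : R) (A : pred (Omega n)) : R :=
  \sum_(w : Omega n | A w) bernoulli_mass p w.

(* $E(Y | A)$; only meaningful when [Pr p A] is nonzero. *)
Definition condE (R : realType) (n : nat) (p : R) (Y : Omega n -> R)
  (A : pred (Omega n)) : R :=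
  (Pr p A)^-1 * \sum_(w : Omega n | A w) Y w * bernoulli_mass p w.

(* Main.v *)
Require Import Defs.
From mathcomp Require Import all_boot all_order all_algebra.
From mathcomp Require Import reals sequences exp.
From mathcomp Require Import topology normedtype.
From mathcomp Require Import ring lra.
Import Order.TTheory GRing.Theory Num.Theory.
Import numFieldNormedType.Exports.
Local Open Scope ring_scope.

(** For a non-decreasing [f], comparing the configurations [w^i] and [w_i]
    coordinate by coordinate shows that
    [(1 - p) E(|pivotal set| ; f = 1) = E(S - n p ; f = 1)], where [S] is the
    number of ones.  By Jensen's inequality for the conditional expectation,
    [P(f = 1) exp (l m) <= E (exp (l (S - n p)))] with
    [m = E(S - n p | f = 1)], and the right-hand side is at most
    [exp (n l^2 / 2)]. Take [l = m / n]. *)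

(** Coefficient comparison behind [cosh x <= exp (x^2 / 2)]: each step of the induction gains a
    factor [2k+1 >= 1]. *)
Lemma leq_exp2_fact_double k : (2 ^ k * k`! <= (k.*2)`!)%N.
Proof.
elim: k => // k IHk; rewrite doubleS !factS expnS.
rewrite (_ : (_ * _ = (k.*2.+2) * (2 ^ k * k`!))%N); last first.
  by rewrite -doubleS -mul2n; ring.
by rewrite leq_mul2l orFb (leq_trans IHk) // leq_pmull.
Qed.

Lemma exp_coeff_sym_odd (R : realType) (x : R) n : odd n ->
  exp_coeff x n + exp_coeff (- x) n = 0.
Proof.
by move=> n_odd; rewrite /exp_coeff /= exprNn -signr_odd n_odd expr1; ring.
Qed.

Lemma exp_coeff_sym_double (R : realType) (x : R) k :
  exp_coeff x k.*2 + exp_coeff (- x) k.*2 <= 2 * exp_coeff (x ^+ 2 / 2) k.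
Proof.
rewrite /exp_coeff /= -mul2n !exprM sqrrN -mulr2n -[leLHS]mulr_natl.
rewrite ler_pM2l // expr_div_n -mulrA ler_wpM2l ?(exprn_ge0 _ (sqr_ge0 x)) //.
rewrite -invfM lef_pV2 ?posrE ?mulr_gt0 ?exprn_gt0 ?ltr0n ?fact_gt0 //.
by rewrite -natrX -natrM ler_nat mul2n leq_exp2_fact_double.
Qed.

(** The power series are compared termwise: odd terms on the left cancel, and the terms of degree
    [2k] are bounded by the [k]-th term on the right. *)
Lemma expRD_expRN_le (R : realType) (x : R) :
  expR x + expR (- x) <= 2 * expR (x ^+ 2 / 2).
Proof.
have cvx := is_cvg_series_exp_coeff x.
have cvNx := is_cvg_series_exp_coeff (- x).
(* [uphalf n] counts the even indices below [n]. *)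
have series_le n : series (exp_coeff x) n + series (exp_coeff (- x)) n <=
    2 * series (exp_coeff (x ^+ 2 / 2)) (uphalf n).
  elim: n => [|n IHn]; first by rewrite /series /= !big_geq // addr0 mulr0.
  rewrite !seriesSr addrACA mulrDr; have := odd_double_half n.
  rewrite uphalf_half in IHn; case: (boolP (odd n)) IHn => [n_odd|_] /= IHn nE.
    by rewrite exp_coeff_sym_odd // addr0 -mulrDr -seriesSr.
  rewrite lerD // -[n in leLHS]nE add0n.
  exact: exp_coeff_sym_double.
rewrite /expR -limD //; apply: limr_le; first exact: is_cvgD.
near=> n; apply: le_trans (series_le n) _; rewrite ler_pM2l //.
apply: nondecreasing_cvgn_le; last exact: is_cvg_series_exp_coeff.
apply: nondecreasing_series => k _ _.
by rewrite exp_coeff_ge0 // divr_ge0 ?sqr_ge0.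
Unshelve. all: by end_near. Qed.

(* Symmetrization: the left-hand side is [E exp (l (X - p))] for [X] Bernoulli,
   which is at most [E exp (l (X - X'))] for an independent copy [X'] of [X]. *)
Lemma bernoulli_mgf_le (R : realType) (p l : R) : 0 <= p <= 1 ->
  p * expR (l * (1 - p)) + (1 - p) * expR (l * (0 - p)) <= expR (l ^+ 2 / 2).
Proof.
case/andP=> p_ge0 p_le1; have q_ge0 : 0 <= 1 - p by rewrite subr_ge0.
set a := expR l; set b := expR (- l).
have ab : a * b = 1 by rewrite -expRD subrr expR0.
have [a_gt0 b_gt0] : 0 < a /\ 0 < b by rewrite !expR_gt0.
(* Jensen for [exp (- l X')]: the tangent at [- l p] is evaluated at [- l] and [0], with weights [p]
   and [1 - p]. *)
have jensen : expR (l * (0 - p)) <= p * b + (1 - p).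
  have /ler_wpM2l tan1 := expR_ge1Dx (l * p - l).
  have /ler_wpM2l tan0 := expR_ge1Dx (l * p).
  have c_ge0 := expR_ge0 (l * (0 - p)).
  have := lerD (ler_wpM2l p_ge0 (tan1 _ c_ge0)) (ler_wpM2l q_ge0 (tan0 _ c_ge0)).
  rewrite -!expRD (_ : l * (0 - p) + (l * p - l) = - l); last by ring.
  by rewrite (_ : l * (0 - p) + l * p = 0) ?expR0 -/b; [lra | ring].
rewrite (_ : l * (1 - p) = l + l * (0 - p)); last by ring.
rewrite expRD -/a; set c := expR _ in jensen *.
have cosh_ge1 : 2 <= a + b.
  by have := lerD (expR_ge1Dx l) (expR_ge1Dx (- l)); rewrite -/a -/b; lra.
have := expRD_expRN_le R l; rewrite -/a -/b => cosh_le.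
(* The symmetrized average is [1 + p (1 - p) (a + b - 2)]; as [p (1 - p) <= 1/2], it is at most
   [(a + b) / 2 = cosh l]. *)
have : 0 <= (1 / 2 - p * (1 - p)) * (a + b - 2).
  by rewrite mulr_ge0 ?subr_ge0 //; nra.
have : (p * a + (1 - p)) * c <= (p * a + (1 - p)) * (p * b + (1 - p)).
  by rewrite ler_wpM2l // addr_ge0 // mulr_ge0 // ltW.
rewrite (_ : _ * (p * b + _) = p ^+ 2 * (a * b) + p * (1 - p) * (a + b)
                               + (1 - p) ^+ 2); last by ring.
by rewrite ab; lra.
Qed.

Section BernoulliProduct.
Variables (R : realType) (n : nat) (p : R).
Implicit Types (w : Omega n) (i : 'I_n) (f : Omega n -> bool).

Definition centered w i : R := (w i)%:R - p.

Lemma bernoulli_mass_ge0 w : 0 <= p <= 1 -> 0 <= bernoulli_mass p w.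
Proof.
case/andP=> p_ge0 p_le1; apply: prodr_ge0 => i _.
by rewrite mulr_ge0 // exprn_ge0 // subr_ge0.
Qed.

(** Exponential and mass both factor over coordinates, so the sum is the [n]-th power of a
    one-coordinate sum. *)
Lemma bernoulli_mgf_sum_le l : 0 <= p <= 1 ->
  \sum_w expR (l * \sum_i centered w i) * bernoulli_mass p w
    <= expR (l ^+ 2 / 2) ^+ n.
Proof.
move=> p01; pose h (b : bool) : R :=
  expR (l * (b%:R - p)) * (p ^+ b * (1 - p) ^+ (1 - b)%N).
under eq_bigr => w _ do
  rewrite mulr_sumr expR_sum -big_split /= -/(\prod_i h (w i)).
rewrite -(bigA_distr_bigA (fun (_ : 'I_n) b => h b)) /= prodr_const card_ord.
rewrite big_bool /h /= !expr0 !expr1 mulr1 mul1r.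
have mgf := bernoulli_mgf_le R p l p01.
apply: lerXn2r; rewrite ?nnegrE ?expR_ge0 //.
  by case/andP: p01 => *; rewrite addr_ge0 // mulr_ge0 ?expR_ge0 ?subr_ge0.
by rewrite mulrC [X in _ + X]mulrC.
Qed.

(** Switching coordinate [i] off maps the configurations with [w i = 1] bijectively onto those with
    [w i = 0]. *)
Lemma sum_set_coord (F : Omega n -> R) i :
  \sum_w F w = \sum_(w : Omega n | w i) (F w + F (set_coord w i false)).
Proof.
rewrite (bigID (fun w : Omega n => w i)) /= big_split /=; congr (_ + _).
rewrite (reindex_onto (fun w : Omega n => set_coord w i false)
                      (fun w => set_coord w i true)) /=; last first.
  move=> w /negbTE wi; apply/ffunP => j; rewrite !ffunE.
  by case: eqP => // ->.
apply: eq_bigl => w; rewrite ffunE eqxx /=; apply/eqP/idP => [<-|wi].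
  by rewrite ffunE eqxx.
by apply/ffunP => j; rewrite !ffunE; case: eqP => // ->.
Qed.

Lemma sum_centered_pivotal f i : nondecreasing_bool f ->
  \sum_(w | f w) centered w i * bernoulli_mass p w =
  (1 - p) * \sum_(w | f w) (pivotal f w i)%:R * bernoulli_mass p w.
Proof.
move=> f_incr; rewrite mulr_sumr !(big_mkcond (fun w => f w)) /=.
rewrite !(sum_set_coord _ i); apply: eq_bigr => w wi.
have set_true : set_coord w i true = w.
  by apply/ffunP => j; rewrite ffunE; case: eqP => // ->.
set w0 := set_coord w i false.
have w0_true : set_coord w0 i true = w.
  by rewrite -[RHS]set_true; apply/ffunP => j; rewrite !ffunE; case: eqP.
have w0_false : set_coord w0 i false = w0.
  by apply/ffunP => j; rewrite !ffunE; case: eqP.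
(* Mass of the other coordinates, common to [w] and [w0]. *)
pose r := \prod_(j | j != i) (p ^+ (w j) * (1 - p) ^+ (1 - w j)%N).
have massw : bernoulli_mass p w = p * r.
  by rewrite /bernoulli_mass (bigD1 i) //= wi expr1 expr0 mulr1.
have massw0 : bernoulli_mass p w0 = (1 - p) * r.
  rewrite /bernoulli_mass (bigD1 i) //= ffunE eqxx expr0 expr1 mul1r.
  by congr (_ * _); apply: eq_bigr => j /negbTE ji; rewrite ffunE ji.
have w0i : w0 i = false by rewrite ffunE eqxx.
rewrite massw massw0 /centered wi w0i /pivotal set_true w0_true w0_false -/w0.
have := f_incr w i; rewrite set_true -/w0.
(* If [f] is 1 at both, the terms [(1 - p) p r] and [- p (1 - p) r] cancel; if only at [w], then [i]
   is pivotal and [p (1 - p) r] remains. Monotonicity excludes 1 at [w0] only. *)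
by case: (f w); case: (f w0) => //= _; ring.
Qed.

Lemma sum_centered_pivotal_set f : nondecreasing_bool f ->
  \sum_(w | f w) (\sum_i centered w i) * bernoulli_mass p w =
  (1 - p) * \sum_(w | f w) #|pivotal_set f w|%:R * bernoulli_mass p w.
Proof.
move=> f_incr; under eq_bigr => w _ do rewrite mulr_suml.
rewrite exchange_big /=.
under eq_bigr => i _ do rewrite sum_centered_pivotal //.
rewrite -mulr_sumr exchange_big /=; congr (_ * _); apply: eq_bigr => w _.
rewrite -mulr_suml -natr_sum -sum1_card [in RHS]big_mkcond /=.
congr (_%:R * _); apply: eq_bigr => i _.
by rewrite inE; case: pivotal.
Qed.

(* Jensen's inequality, from the tangent to [expR] at [l * m]. *)
Lemma expR_cond_mean_le (A : pred (Omega n)) (Y : Omega n -> R) (l m : R) :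
  0 <= p <= 1 -> \sum_(w | A w) Y w * bernoulli_mass p w = Pr p A * m ->
  Pr p A * expR (l * m) <= \sum_w expR (l * Y w) * bernoulli_mass p w.
Proof.
move=> p01 meanY.
have mass_ge0 w := bernoulli_mass_ge0 w p01.
apply: (@le_trans _ _ (\sum_(w | A w) expR (l * Y w) * bernoulli_mass p w)).
  (* The linear part of the tangent sums to zero over [A], where [Y] has mean [m]. *)
  have -> : Pr p A * expR (l * m) = \sum_(w | A w)
      expR (l * m) * (1 + (l * Y w - l * m)) * bernoulli_mass p w.
    transitivity (\sum_(w | A w) (expR (l * m) * (1 - l * m) * bernoulli_mass p w
        + expR (l * m) * l * (Y w * bernoulli_mass p w))).
      by rewrite big_split /= -!mulr_sumr meanY -/(Pr p A); ring.
    by apply: eq_bigr => w _; ring.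
  apply: ler_sum => w _; apply: ler_wpM2r => //.
  have -> : l * Y w = l * m + (l * Y w - l * m) by ring.
  rewrite expRD (_ : l * m + _ - _ = l * Y w - l * m); last by ring.
  by rewrite ler_wpM2l ?expR_ge0 ?expR_ge1Dx.
rewrite [leRHS](bigID A) /= lerDl sumr_ge0 // => w _.
by rewrite mulr_ge0 ?expR_ge0.
Qed.

End BernoulliProduct.

Theorem corollary9p2 (R : realType) (n : nat) (p : R) (f : Omega n -> bool)
  (hn : (1 <= n)%N) (hp : 0 <= p <= 1)
  (hf : nondecreasing_bool f)
  (hpos : 0 < Pr p (fun w => f w == true)) :
  Pr p (fun w => f w == true) <=
    2 * expR (- (1 / (2 * n%:R)) *
      ((1 - p) *
        condE p (fun w => #|pivotal_set f w|%:R) (fun w => f w == true)) ^+ 2).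
Proof.
set A := fun w => f w == true; set m := (1 - p) * _.
have n_neq0 : n%:R != 0 :> R by rewrite pnatr_eq0 -lt0n.
have mean : \sum_(w | A w) (\sum_i centered R n p w i) * bernoulli_mass p w =
    Pr p A * m.
  rewrite /m /condE mulrCA mulVKf ?gt_eqF //.
  under eq_bigl => w do rewrite /A eqb_id.
  under [in RHS]eq_bigl => w do rewrite /A eqb_id.
  exact: sum_centered_pivotal_set.
have := le_trans (expR_cond_mean_le R n p A _ (m / n%:R) m hp mean)
                 (bernoulli_mgf_sum_le R n p (m / n%:R) hp).
(* With [l = m / n], the exponent [n l^2 / 2 - l m] is [- m^2 / (2n)]. *)
rewrite -expRM_natl -ler_pdivlMr ?expR_gt0 // -expRB.
rewrite (_ : _ - _ = - (1 / (2 * n%:R)) * m ^+ 2); last by field.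
by move/le_trans; apply; rewrite ler_peMl ?expR_ge0 ?ler1n.
Qed.
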